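(* There is an absolute constant $C>0$ such that for every integer $d \ge 2$ the following holds: if $P \subseteq \mathbb{R}^d$ is a lattice polytope (all vertices in $\mathbb{Z}^d$) whose vertex set is in general position and whose interior contains no point of $\mathbb{Z}^d$, then $P$ has at most $C\, d^2 (\log d)^3$ vertices.
   Context: A set of points in $\mathbb{R}^d$ is in general position if no $d+1$ of its points lie in a common (affine) hyperplane. *)

(* Defs.v *)
From Stdlib Require Import Rdefinitions Rpower.
From HB Require Import structures.
From mathcomp Require Import all_boot all_order all_algebra.
From mathcomp Require Import Rstruct.
Set Implicit Arguments. Unset Strict Implicit. Unset Printing Implicit Defensive.
Import Order.TTheory GRing.Theory Num.Theory.
Local Open Scope ring_scope.

Notation Rr := Rdefinitions.R.

Definition lattice_point (d : nat) (x : 'rV[Rr]_d) : Prop :=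
  forall i : 'I_d, exists z : int, x 0 i = z%:~R.

Definition in_conv (d : nat) (S : seq 'rV[Rr]_d) (x : 'rV[Rr]_d) : Prop :=
  exists w : 'I_(size S) -> Rr,
    (forall i, 0 <= w i) /\ \sum_i w i = 1 /\ x = \sum_i w i *: S`_i.

(* x is an interior point (in the Euclidean topology of R^d; we use the
   equivalent sup-norm neighbourhoods) of conv S *)
Definition in_interior_conv (d : nat) (S : seq 'rV[Rr]_d) (x : 'rV[Rr]_d) : Prop :=
  exists e : Rr, 0 < e /\
    forall y : 'rV[Rr]_d, (forall i, `|y 0 i - x 0 i| < e) -> in_conv S y.

(* V (duplicate-free) is exactly the vertex set of conv V:
   no point of V is a convex combination of the others *)
Definition vertex_set (d : nat) (V : seq 'rV[Rr]_d) : Prop :=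
  uniq V /\ forall v, v \in V -> ~ in_conv (rem v V) v.

Definition on_hyperplane (d : nat) (a : 'rV[Rr]_d) (b : Rr) (x : 'rV[Rr]_d) : bool :=
  (x *m a^T) 0 0 == b.

Definition general_position (d : nat) (V : seq 'rV[Rr]_d) : Prop :=
  uniq V /\
  forall (a : 'rV[Rr]_d) (b : Rr), a != 0 -> (count (on_hyperplane a b) V <= d)%N.

(* Main.v *)
Require Import Defs.
From Stdlib Require Import Rdefinitions Rpower.
From HB Require Import structures.
From mathcomp Require Import all_boot all_order all_algebra all_field.
From mathcomp Require Import Rstruct ring lra zify.
Set Implicit Arguments. Unset Strict Implicit. Unset Printing Implicit Defensive.
Import Order.TTheory GRing.Theory Num.Theory.
Local Open Scope ring_scope.

(* No flatness theorem is used. By general position, a point of the hull whose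
   convex weights are positive on d + 1 vertices is interior, so it suffices to
   find a lattice point with such weights, of the form w / p for a huge prime p.
   Translating by a vertex v_0, this asks for sum_j w_j (v_(i_j) - v_0) = 0 in
   F_p^d with positive integers w_j of total less than p, the remaining weight
   going to v_0. Here i_1, ..., i_d are fixed, i_(d+1), ..., i_(d+m) are free
   and w_j = w' + w'' with w', w'' in [1, L], so that in the Fourier expansion
   of the number of solutions each index contributes |D(a)|^2, where D is a
   Dirichlet kernel and sum_a |D(a)|^2 = p L. General position survives modulo p:
   for y <> 0, the map i |-> <y, v_i> takes each value at most d times. Hence
   the nontrivial characters contribute at most (p L)^d (d p L)^m against the
   main term L^(2(d+m)) n^m. With L about p / (2(d+m)) and m about d log d, a
   solution exists as soon as n exceeds a multiple of d (d + m), which gives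
   even n = O(d^2 log d). *)

(** * Character sums and the dot product *)

Lemma sum_nontrivial_character (G : finZmodType) (phi : G -> algC) (g0 : G) :
  {morph phi : a b / a + b >-> a * b} -> phi g0 != 1 -> \sum_g phi g = 0.
Proof.
move=> phiD phi_g0; have /eqP : phi g0 * \sum_g phi g = \sum_g phi g.
  rewrite mulr_sumr [RHS](reindex_inj (addrI g0)) /=.
  by apply: eq_bigr => g _; rewrite phiD.
rewrite -subr_eq0 -{2}[\sum_g phi g]mul1r -mulrBl mulf_eq0 subr_eq0.
by rewrite (negPf phi_g0) => /eqP.
Qed.

Definition dot (R : comNzRingType) (d : nat) (x y : 'rV[R]_d) : R := (x *m y^T) 0 0.

Lemma dotE (R : comNzRingType) (d : nat) (x y : 'rV[R]_d) :
  dot x y = \sum_k x 0 k * y 0 k.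
Proof. by rewrite /dot mxE; apply: eq_bigr => k _; rewrite mxE. Qed.

Lemma dotDr (R : comNzRingType) (d : nat) (x y z : 'rV[R]_d) :
  dot x (y + z) = dot x y + dot x z.
Proof. by rewrite /dot linearD mulmxDr mxE. Qed.

Lemma dotDl (R : comNzRingType) (d : nat) (x y z : 'rV[R]_d) :
  dot (x + y) z = dot x z + dot y z.
Proof. by rewrite /dot mulmxDl mxE. Qed.

Lemma dotBl (R : comNzRingType) (d : nat) (x y z : 'rV[R]_d) :
  dot (x - y) z = dot x z - dot y z.
Proof. by rewrite /dot mulmxBl !mxE. Qed.

Lemma dotBr (R : comNzRingType) (d : nat) (x y z : 'rV[R]_d) :
  dot x (y - z) = dot x y - dot x z.
Proof. by rewrite /dot linearB mulmxBr !mxE. Qed.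

Lemma dotZl (R : comNzRingType) (d : nat) (a : R) (x y : 'rV[R]_d) :
  dot (a *: x) y = a * dot x y.
Proof. by rewrite /dot -scalemxAl mxE. Qed.

Lemma dot0r (R : comNzRingType) (d : nat) (x : 'rV[R]_d) : dot x 0 = 0.
Proof. by rewrite /dot trmx0 mulmx0 mxE. Qed.

Lemma dot_suml (R : comNzRingType) (d : nat) (I : finType) (x : I -> 'rV[R]_d) y :
  dot (\sum_i x i) y = \sum_i dot (x i) y.
Proof. by rewrite /dot mulmx_suml summxE. Qed.

(** * Exponential sums over a finite field *)

Section Fourier.
Variables (F : finFieldType) (chi : F -> algC) (c0 : F).
Hypothesis chiD : {morph chi : a b / a + b >-> a * b}.
Hypothesis norm_chi : forall a, `|chi a| = 1.
Hypothesis chi_c0 : chi c0 != 1.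

Lemma chi0 : chi 0 = 1.
Proof.
have: chi 0 != 0 by rewrite -normr_eq0 norm_chi oner_eq0.
by move/mulfI; apply; rewrite -chiD addr0 mulr1.
Qed.

Lemma chi_conj a : (chi a)^* = chi (- a).
Proof.
have nz : chi a != 0 by rewrite -normr_eq0 norm_chi oner_eq0.
apply: (mulfI nz); rewrite -chiD subrr chi0 -normCK norm_chi expr1n //.
Qed.

Lemma chi_sum (I : finType) (f : I -> F) : chi (\sum_i f i) = \prod_i chi (f i).
Proof. by elim/big_rec2: _ => [|i x y _ <-]; rewrite ?chi0 ?chiD. Qed.

Lemma sum_chi_mulr b : b != 0 -> \sum_a chi (a * b) = 0.
Proof.
move=> b0; apply: (@sum_nontrivial_character F _ (c0 / b)); last by rewrite divfK.
by move=> a a'; rewrite mulrDl chiD.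
Qed.

Lemma sum_chi_dot (d : nat) (x : 'rV[F]_d) : x != 0 -> \sum_y chi (dot x y) = 0.
Proof.
move=> /rV0Pn[k xk].
(* The witness is a multiple of a unit vector whose product with [x] is [c0], where [chi] differs
   from 1. *)
apply: (@sum_nontrivial_character 'rV[F]_d _ ((c0 / x 0 k) *: delta_mx 0 k)).
  by move=> a a'; rewrite dotDr chiD.
rewrite dotE (bigD1 k) //= big1 => [|j jk]; rewrite !mxE !eqxx ?(negPf jk) ?mulr0 //.
by rewrite addr0 /= mulr1 mulrC divfK.
Qed.

(** For each [i] the sum over all [y] vanishes, so the term [y = 0], which equals [#|I|], is
    cancelled by the others. *)
Lemma card_le_exponential_sums (d : nat) (I : finType) (g : I -> 'rV[F]_d) :
  (forall i, g i != 0) ->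
  #|I|%:R <= \sum_(y | y != 0) `|\sum_i chi (dot (g i) y)|.
Proof.
move=> g0.
have : \sum_y \sum_i chi (dot (g i) y) = 0.
  by rewrite exchange_big big1 // => i _; rewrite sum_chi_dot.
rewrite (bigD1 0) //= => /eqP; rewrite addr_eq0 => /eqP h.
suff <- : `|\sum_i chi (dot (g i) 0)| = #|I|%:R by rewrite h normrN ler_norm_sum.
under eq_bigr do rewrite dot0r chi0.
by rewrite sumr_const normr_nat.
Qed.

Variable L : nat.
Hypothesis natL_inj : forall w w', (w < L)%N -> (w' < L)%N ->
  w%:R = w'%:R :> F -> w = w'.

(** The Dirichlet kernel of the integers from 1 to [L]; starting at 1 keeps all weights positive. *)
Definition kernel (a : F) : algC := \sum_(w < L) chi (a * w.+1%:R).
Definition energy a := `|kernel a| ^+ 2.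

Lemma energy_ge0 a : 0 <= energy a.
Proof. by rewrite exprn_ge0. Qed.

(** Parseval: once the square is expanded, summing over [a] kills every pair [w <> w'], as
    [natL_inj] makes their difference nonzero in [F]. *)
Lemma sum_energy : \sum_a energy a = (#|F| * L)%:R.
Proof.
transitivity (\sum_a \sum_(w < L) \sum_(w' < L) chi (a * (w%:R - w'%:R))).
  apply: eq_bigr => a _; rewrite /energy normCK /kernel rmorph_sum mulr_suml.
  apply: eq_bigr => w _; rewrite mulr_sumr; apply: eq_bigr => w' _.
  rewrite /= chi_conj -chiD -mulrN -mulrDr -!natr1; congr (chi (_ * _)).
  by rewrite opprD addrACA subrr addr0.
rewrite exchange_big /= natrM mulr_natr -[L in RHS]card_ord -sumr_const.
apply: eq_bigr => w _; rewrite exchange_big (bigD1 w) //= [X in _ + X]big1 => [|w' w'w].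
  by rewrite addr0 subrr; under eq_bigr do rewrite mulr0 chi0; rewrite sumr_const.
apply: sum_chi_mulr; rewrite subr_eq0; apply: contraNneq w'w => h.
by apply/eqP/ord_inj/natL_inj; rewrite ?ltn_ord.
Qed.

(** With two summands the exponential sum is the square of the kernel, whose modulus is an [energy]
    and so falls under Parseval. *)
Definition weight (w : 'I_L * 'I_L) : nat := w.1.+1 + w.2.+1.

Lemma sum_chi_weight a : \sum_w chi (a * (weight w)%:R) = kernel a ^+ 2.
Proof.
rewrite expr2 /kernel mulr_suml -(pair_bigA _ (fun u v => chi (a * (weight (u, v))%:R))) /=.
apply: eq_bigr => w _; rewrite mulr_sumr; apply: eq_bigr => w' _.
by rewrite -chiD -mulrDr -natrD.
Qed.


(** * Weighted zero sums by the circle method *)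

Section ZeroSum.
Variables (d n m k : nat) (x : 'I_n -> 'rV[F]_d) (b : 'I_d -> 'I_n).
Hypothesis fiber_x : forall y c, y != 0 -> (#|[pred i | dot (x i) y == c]| <= k)%N.
Hypothesis free_b : forall y, (forall j, dot (x (b j)) y = 0) -> y = 0.

(** Grouping the indices by the value of [dot (x i) y] counts each energy at most [k] times;
    Parseval bounds the total. *)
Lemma sum_energy_fibers y : y != 0 ->
  \sum_i energy (dot (x i) y) <= (k * (#|F| * L))%:R.
Proof.
move=> y0; rewrite (partition_big (fun i => dot (x i) y) predT) //=.
rewrite natrM -sum_energy mulr_sumr; apply: ler_sum => c _.
rewrite (eq_bigr (fun=> energy c)) => [|i /eqP-> //].
rewrite sumr_const -[leLHS]mulr_natl ler_wpM2r ?energy_ge0 // ler_nat.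
exact: fiber_x.
Qed.

(** By [free_b], [y] is determined by its [d] products with the [x (b j)]. The sum is therefore part
    of a sum over all [d]-tuples, which factors into [d] copies of Parseval. *)
Lemma sum_prod_energy :
  \sum_y \prod_j energy (dot (x (b j)) y) <= ((#|F| * L) ^ d)%:R.
Proof.
pose ev (y : 'rV[F]_d) : {ffun 'I_d -> F} := [ffun j => dot (x (b j)) y].
have ev_inj : injective ev.
  move=> y y' /ffunP eq_ev; apply/eqP; rewrite -subr_eq0; apply/eqP/free_b => j.
  by have:= eq_ev j; rewrite !ffunE dotBr => ->; rewrite subrr.
rewrite (eq_bigr (fun y => \prod_j energy (ev y j))); last first.
  by move=> y _; apply: eq_bigr => j _; rewrite ffunE.
pose E (t : {ffun 'I_d -> F}) := \prod_j energy (t j).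
rewrite -[leLHS](big_imset (h := ev) (A := predT) E) /=; last by move=> ? ? _ _ /ev_inj.
have -> : ((#|F| * L) ^ d)%:R = \sum_t E t.
  by rewrite -(bigA_distr_bigA (fun=> energy)) /= prodr_const card_ord sum_energy natrX.
rewrite [leRHS](bigID [in ev @: predT]) /= lerDl sumr_ge0 // => t _.
by rewrite prodr_ge0 // => j _; exact: energy_ge0.
Qed.

(** The first component only weights the fixed indices [b]; the second chooses both indices and
    weights, and repetitions are allowed. *)
Definition config := ({ffun 'I_d -> 'I_L * 'I_L} * {ffun 'I_m -> 'I_n * ('I_L * 'I_L)})%type.

Definition config_sum (s : config) : 'rV[F]_d :=
  \sum_j (weight (s.1 j))%:R *: x (b j) + \sum_j (weight (s.2 j).2)%:R *: x (s.2 j).1.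

Lemma config_exponential_sum y :
  \sum_s chi (dot (config_sum s) y) =
  (\prod_j kernel (dot (x (b j)) y) ^+ 2) * (\sum_i kernel (dot (x i) y) ^+ 2) ^+ m.
Proof.
transitivity (\prod_j (\sum_w chi (dot (x (b j)) y * (weight w)%:R)) *
  \prod_(j < m) \sum_r chi (dot (x r.1) y * (weight r.2)%:R)).
  rewrite !bigA_distr_bigA mulr_suml.
  rewrite -(pair_bigA _ (fun w r => chi (dot (config_sum (w, r)) y))) /=.
  apply: eq_bigr => w _; rewrite mulr_sumr; apply: eq_bigr => r _.
  rewrite dotDl !dot_suml chiD !chi_sum.
  by congr (_ * _); apply: eq_bigr => j _; rewrite dotZl mulrC.
congr (_ * _); first by apply: eq_bigr => j _; rewrite sum_chi_weight.
rewrite prodr_const card_ord; congr (_ ^+ _).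
rewrite -(pair_bigA _ (fun i w => chi (dot (x i) y * (weight w)%:R))) /=.
by apply: eq_bigr => i _; rewrite sum_chi_weight.
Qed.

(* If no configuration had sum zero, the trivial character would have to be
   cancelled by the others, each of which is bounded by Parseval: on the fixed
   indices [b] through injectivity, on the free ones through [fiber_x]. *)
Lemma exists_zero_config :
  ((#|F| * L) ^ d * (k * (#|F| * L)) ^ m < (L * L) ^ d * (n * (L * L)) ^ m)%N ->
  exists s, config_sum s = 0.
Proof.
move=> small; suff /existsP[s /eqP s0]: [exists s, config_sum s == 0] by exists s.
apply: contraLR small; rewrite negb_exists => /forallP nz.
rewrite -leqNgt -(ler_nat algC).
have -> : ((L * L) ^ d * (n * (L * L)) ^ m)%N = #|{: config}|.
  by rewrite card_prod !card_ffun !card_prod !card_ord.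
apply: le_trans (card_le_exponential_sums nz) _.
apply: (@le_trans _ _ (\sum_(y | y != 0)
  (\prod_j energy (dot (x (b j)) y)) * ((k * (#|F| * L)) ^ m)%:R)).
  apply: ler_sum => y y0; rewrite config_exponential_sum normrM normr_prod normrX.
  apply: ler_pM; rewrite ?prodr_ge0 ?exprn_ge0 //.
    by rewrite le_eqVlt; apply/orP; left; apply/eqP/eq_bigr => j _; rewrite normrX.
  rewrite natrX lerXn2r ?nnegrE ?ler0n //.
  apply: le_trans (ler_norm_sum _ _ _) _; under eq_bigr do rewrite normrX.
  exact: sum_energy_fibers.
rewrite -mulr_suml natrM ler_wpM2r ?ler0n //.
apply: le_trans _ sum_prod_energy.
rewrite [leRHS](bigID [pred y | y != 0]) /= lerDl sumr_ge0 // => y _.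
by rewrite prodr_ge0 // => j _; exact: energy_ge0.
Qed.

End ZeroSum.
End Fourier.

(** Exponents of a primitive [p]-th root of unity [z] matter only modulo [p], so [a |-> z ^+ a] is
    additive. *)
Lemma Fp_additive_character (p : nat) : prime p ->
  exists chi : 'F_p -> algC, [/\ {morph chi : a b / a + b >-> a * b},
    forall a, `|chi a| = 1 & chi 1 != 1].
Proof.
move=> p_pr; have [z z_prim] := C_prim_root_exists (prime_gt0 p_pr).
exists (fun a => z ^+ (a : nat)); split=> [a b|a|].
- rewrite -exprD -[RHS](prim_expr_mod z_prim) /=; congr (z ^+ (_ %% _)); exact: Fp_cast.
- rewrite normrX; suff -> : `|z| = 1 by rewrite expr1n.
  apply/eqP; rewrite -(pexpr_eq1 (prime_gt0 p_pr)) // -normrX.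
  by rewrite (prim_expr_order z_prim) normr1.
rewrite /= -[X in _ != X](expr0 z) (eq_prim_root_expr z_prim) Fp_cast //.
by rewrite mod0n modn_mod modn_small ?prime_gt1.
Qed.

(** * Affine dependence and general position through determinants *)

Section Affine.
Variable R : comNzRingType.
(** Homogeneous coordinates: a product on the left records a combination with its total weight, a
    product on the right evaluates an affine function. *)
Definition affine_mx (k d : nat) (v : 'I_k -> 'rV[R]_d) : 'M[R]_(k, d + 1) :=
  \matrix_(i < k) row_mx (v i) (const_mx 1).

Lemma eq_affine_mx (k d : nat) (v v' : 'I_k -> 'rV[R]_d) :
  v =1 v' -> affine_mx v = affine_mx v'.
Proof. by move=> vv'; apply/row_matrixP=> i; rewrite !rowK vv'. Qed.

Lemma mul_affine_mx (k d : nat) (v : 'I_k -> 'rV[R]_d) (w : 'rV[R]_k) :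
  w *m affine_mx v = row_mx (\sum_i w 0 i *: v i) (const_mx (\sum_i w 0 i)).
Proof.
rewrite mulmx_sum_row; apply/rowP=> j; rewrite summxE.
case: (split_ordP j) => j' ->; rewrite ?row_mxEl ?row_mxEr ?summxE ?mxE;
  apply: eq_bigr => i _; rewrite 3!mxE ?row_mxEl ?row_mxEr mxE ?mulr1 //.
Qed.

Lemma affine_mx_mul (k d : nat) (v : 'I_k -> 'rV[R]_d) (y : 'rV[R]_d) (c : R) i :
  (affine_mx v *m (row_mx y (const_mx c))^T) i 0 = dot (v i) y + c.
Proof.
rewrite mxE big_split_ord /= big_ord1 dotE; congr (_ + _).
  by apply: eq_bigr => j _; rewrite [affine_mx _ _ _]mxE [_^T _ _]mxE !row_mxEl.
by rewrite [affine_mx _ _ _]mxE [_^T _ _]mxE !row_mxEr !mxE mul1r.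
Qed.
End Affine.

Lemma map_affine_mx (R S : comNzRingType) (f : {rmorphism R -> S}) k d
    (v : 'I_k -> 'rV[R]_d) :
  map_mx f (affine_mx v) = affine_mx (fun i => map_mx f (v i)).
Proof.
apply/matrixP=> i j; rewrite !mxE; case: splitP => j' _; rewrite !mxE //.
exact: rmorph1.
Qed.

Lemma det_affine_mx_eq0 (F : fieldType) (d : nat) (v : 'I_(d + 1) -> 'rV[F]_d) :
  (exists y c, y != 0 /\ forall i, dot (v i) y = c) <-> \det (affine_mx v) = 0.
Proof.
split=> [[y [c [y0 yc]]]|/eqP].
  apply/eqP; rewrite -det_tr; apply/det0P; exists (row_mx y (const_mx (- c))).
    by apply: contraNneq y0; rewrite -row_mx0 => /eq_row_mx[->].
  apply: trmx_inj; rewrite trmx_mul trmxK trmx0; apply/colP=> i.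
  by rewrite affine_mx_mul yc subrr mxE.
rewrite -det_tr => /det0P[w w0 wA]; exists (lsubmx w), (- rsubmx w 0 0).
have {}wA i : dot (v i) (lsubmx w) + rsubmx w 0 0 = 0.
  rewrite -affine_mx_mul; have -> : const_mx (rsubmx w 0 0) = rsubmx w.
    by apply/rowP=> j; rewrite ord1 mxE.
  by rewrite hsubmxK -[affine_mx v]trmxK -trmx_mul wA !mxE.
split=> [|i]; last by apply/eqP; rewrite -addr_eq0 wA.
apply: contraNneq w0 => w1; rewrite -[w]hsubmxK w1.
(* Any of the [d + 1 > 0] rows would do: with zero linear part, the column of ones forces the
   constant to vanish too. *)
have := wA (rshift d 0); rewrite w1 dot0r add0r => w2.
by apply/eqP/rowP=> j; rewrite -row_mx0; congr (row_mx _ _ _ _);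
  apply/rowP=> j'; rewrite ord1 w2 mxE.
Qed.

Lemma card_gt_inj (T : finType) (A : {pred T}) (k : nat) : (k <= #|A|)%N ->
  exists2 f : 'I_k -> T, injective f & forall i, f i \in A.
Proof.
move=> kA; exists (fun i => enum_val (widen_ord kA i)) => [i j|i].
  by move/enum_val_inj => /(congr1 val) /= ?; exact: val_inj.
exact: enum_valP.
Qed.

Lemma general_position_det (d : nat) (V : seq 'rV[Rr]_d) (f : 'I_(d + 1) -> 'I_(size V)) :
  general_position V -> injective f -> \det (affine_mx (fun i => V`_(f i))) != 0.
Proof.
move=> [_ gp] f_inj; apply/eqP => /det_affine_mx_eq0[y [c [y0 yc]]].
have := gp y c y0; rewrite leqNgt => /negP; apply.
rewrite -sum1_count (big_nth 0) big_mkord sum1_card -addn1 -[(d + 1)%N]card_ord.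
rewrite -(card_imset predT f_inj); apply/subset_leq_card/subsetP => _ /imsetP[i _ ->].
by apply/eqP; exact: yc.
Qed.

(** A fibre with [d + 1] indices would make [p] divide their integer determinant, which is nonzero
    and smaller than [p] in absolute value. *)
Lemma Fp_fiber_bound (d n p : nat) (z : 'I_n -> 'rV[int]_d) : prime p ->
  (forall f : 'I_(d + 1) -> 'I_n, injective f ->
     (0 < `|\det (affine_mx (z \o f))| < p)%N) ->
  forall (y : 'rV['F_p]_d) c, y != 0 ->
  (#|[pred i | dot (map_mx intr (z i)) y == c]| <= d)%N.
Proof.
move=> p_pr detP y c y0; rewrite leqNgt; apply/negP; rewrite -addn1.
move=> /card_gt_inj[f f_inj fP]; have /andP[det0 detp] := detP f f_inj.
have : \det (affine_mx (fun i => map_mx intr (z (f i)) : 'rV['F_p]_d)) = 0.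
  by apply/det_affine_mx_eq0; exists y, c; split=> // i; have /eqP := fP i.
rewrite -(map_affine_mx intr (z \o f)) det_map_mx => /eqP.
by rewrite -(dvdz_pcharf (pchar_Fp p_pr)) dvdzE /= gtnNdvd.
Qed.

(** * Interior points from positive weights on a simplex *)

Lemma interior_of_simplex_weights (d : nat) (V : seq 'rV[Rr]_d)
    (f : 'I_(d + 1) -> 'I_(size V)) (lam : 'I_(size V) -> Rr) (eps : Rr) :
  injective f -> \det (affine_mx (fun i => V`_(f i))) != 0 ->
  (forall i, 0 <= lam i) -> \sum_i lam i = 1 ->
  0 < eps -> (forall j, eps <= lam (f j)) ->
  in_interior_conv V (\sum_i lam i *: V`_i).
Proof.
move=> f_inj det_f lam0 lam1 eps0 lam_f.
set U := affine_mx _ in det_f; set X := \sum_i _.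
(* [S] bounds how much a displacement is magnified in barycentric coordinates; the 1 makes it
   positive. *)
pose S : Rr := 1 + \sum_k \sum_j `|invmx U k j|.
have S0 : 0 < S by rewrite ltr_pwDl // sumr_ge0 // => k _; rewrite sumr_ge0.
exists (eps / S); split=> [|y yX]; first by rewrite divr_gt0.
(* The displacement is absorbed by the simplex alone. The final 0 makes the corrections sum to zero,
   and each is at most [eps], so the new weights stay nonnegative with total 1. *)
pose del := row_mx (y - X) (const_mx 0 : 'rV_1) *m invmx U.
have delU : del *m U = row_mx (y - X) (const_mx 0).
  by rewrite mulmxKV // unitmxE unitfE.
have del_le j : `|del 0 j| <= eps.
  rewrite mxE; apply: le_trans (ler_norm_sum _ _ _) _.
  apply: (@le_trans _ _ (\sum_k eps / S * `|invmx U k j|)).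
    apply: ler_sum => k _; rewrite normrM ler_wpM2r // mxE.
    case: splitP => k' _; rewrite !mxE; first exact/ltW/yX.
    by rewrite normr0 divr_ge0 // ltW.
  rewrite -mulr_sumr mulrAC ler_pdivrMr // ler_wpM2l ?(ltW eps0) // /S.
  rewrite ler_wpDl // ler_sum // => k _.
  by rewrite (bigD1 j) //= lerDl sumr_ge0.
move: delU; rewrite mul_affine_mx => /eq_row_mx[delV del1].
exists (fun i => lam i + \sum_j (del 0 j *+ (f j == i))); split=> [i|].
  have [j /eqP fj|nf] := pickP (fun j => f j == i).
    rewrite (bigD1 j) //= fj eqxx mulr1n big1 ?addr0 => [|j' jj'].
      by rewrite -fj; have := lam_f j; have := del_le j; rewrite ler_norml; lra.
    by rewrite -fj (inj_eq f_inj) (negPf jj').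
  by rewrite big1 ?addr0 // => j _; rewrite nf.
have pushE (W : lmodType Rr) (g : 'I_(size V) -> W) :
    \sum_i (\sum_j del 0 j *+ (f j == i)) *: g i = \sum_j del 0 j *: g (f j).
  under eq_bigr do rewrite scaler_suml.
  rewrite exchange_big /=; apply: eq_bigr => j _.
  rewrite (bigD1 (f j)) //= eqxx mulr1n big1 ?addr0 // => i /negPf.
  by rewrite eq_sym => ->; rewrite mulr0n scale0r.
split.
  have push1 : \sum_i \sum_j del 0 j *+ (f j == i) = \sum_j del 0 j.
    transitivity (\sum_i (\sum_j del 0 j *+ (f j == i)) *: (1 : Rr^o)).
      by apply: eq_bigr => i _; rewrite -[LHS]mulr1.
    by rewrite pushE; apply: eq_bigr => j _; exact: mulr1.
  rewrite big_split /= lam1 push1.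
  have /matrixP/(_ 0 0) := del1; rewrite !mxE => ->.
  exact: addr0.
under eq_bigr do rewrite scalerDl.
by rewrite big_split /= -/X pushE delV addrC subrK.
Qed.

(** * Lattice points and reduction modulo [p] *)

Lemma lattice_point_int (d : nat) (x : 'rV[Rr]_d) :
  lattice_point x -> exists z : 'rV[int]_d, x = map_mx intr z.
Proof.
move=> xZ; exists (map_mx Num.floor x); apply/rowP=> i; rewrite !mxE.
by have [z ->] := xZ i; rewrite intrKfloor.
Qed.

Lemma lattice_point_map (d : nat) (z : 'rV[int]_d) : lattice_point (map_mx intr z).
Proof. by move=> i; exists (z 0 i); rewrite mxE. Qed.

Lemma map_mx_intr_Fp_eq0 (d p : nat) (z : 'rV[int]_d) : prime p ->
  map_mx (intr : int -> 'F_p) z = 0 -> exists q, z = p%:Z *: q.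
Proof.
move=> p_pr /rowP z0; exists (map_mx (fun a => (a %/ p)%Z) z); apply/rowP=> i.
rewrite !mxE mulrC divzK // (dvdz_pcharf (pchar_Fp p_pr)).
by have := z0 i; rewrite !mxE => ->.
Qed.

Lemma Fp_nat_inj (p L : nat) : prime p -> (L <= p)%N ->
  forall w w', (w < L)%N -> (w' < L)%N -> w%:R = w'%:R :> 'F_p -> w = w'.
Proof.
move=> p_pr Lp w w' wL w'L /(congr1 (fun a : 'F_p => a : nat)).
by rewrite !val_Fp_nat // !modn_small // (leq_trans _ Lp).
Qed.

(** * From a zero sum to an interior lattice point *)

Section Combination.
Variables (T I J : finType) (i0 : T) (b : I -> T) (r : J -> T).
Variables (u : I -> Rr) (v : J -> Rr) (h : Rr).

(** Indices may repeat within [b] and [r] or coincide with [i0], so the weights are collected at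
    each vertex. *)
Definition combined_weight (t : T) : Rr :=
  \sum_(i | b i == t) u i + \sum_(j | r j == t) v j + h *+ (i0 == t).

Lemma sum_combined_weight (W : lmodType Rr) (g : T -> W) :
  \sum_t combined_weight t *: g t =
  \sum_i u i *: g (b i) + \sum_j v j *: g (r j) + h *: g i0.
Proof.
under eq_bigr do rewrite !scalerDl.
rewrite !big_split /=; congr (_ + _ + _).
- rewrite [RHS](partition_big b predT) //=; apply: eq_bigr => t _.
  by rewrite scaler_suml; apply: eq_bigr => i /eqP->.
- rewrite [RHS](partition_big r predT) //=; apply: eq_bigr => t _.
  by rewrite scaler_suml; apply: eq_bigr => i /eqP->.
rewrite (bigD1 i0) //= eqxx mulr1n big1 ?addr0 // => t /negPf.
by rewrite eq_sym => ->; rewrite mulr0n scale0r.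
Qed.

Lemma total_combined_weight :
  \sum_t combined_weight t = \sum_i u i + \sum_j v j + h.
Proof.
rewrite (eq_bigr (fun t => combined_weight t *: (1 : Rr^o))); last first.
  by move=> t _; rewrite -[LHS]mulr1.
rewrite sum_combined_weight; congr (_ + _ + _); last exact: mulr1.
  by apply: eq_bigr => i _; exact: mulr1.
by apply: eq_bigr => j _; exact: mulr1.
Qed.
End Combination.

(** Replacing [p] by [L * Q] lets the powers of [L] cancel. The remaining condition is free of [p],
    which can thus be taken as large as desired. *)
Lemma counting_bound (d m n k p L Q : nat) :
  (0 < d)%N -> (0 < m)%N -> (0 < L)%N -> (p <= L * Q)%N -> (Q ^ d * (k * Q) ^ m < n ^ m)%N ->
  ((p * L) ^ d * (k * (p * L)) ^ m < (L * L) ^ d * (n * (L * L)) ^ m)%N.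
Proof.
move=> d0 m0 L0 pLQ small.
apply: (@leq_ltn_trans ((L * L * Q) ^ d * (k * (L * L * Q)) ^ m)).
  have h : (p * L <= L * L * Q)%N by rewrite mulnC -mulnA leq_mul2l pLQ orbT.
  by rewrite leq_mul // leq_exp2r // leq_mul.
have -> : ((L * L * Q) ^ d * (k * (L * L * Q)) ^ m =
   ((L * L) ^ d * (L * L) ^ m) * (Q ^ d * (k * Q) ^ m))%N by rewrite !expnMn; ring.
have -> : ((L * L) ^ d * (n * (L * L)) ^ m = ((L * L) ^ d * (L * L) ^ m) * n ^ m)%N.
  by rewrite !expnMn; ring.
by rewrite ltn_pmul2l // muln_gt0 !expn_gt0 !muln_gt0 L0.
Qed.

Lemma exists_interior_lattice_point (d m Q : nat) (V : seq 'rV[Rr]_d) :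
  (0 < d)%N -> (0 < m)%N -> (d < size V)%N -> (4 * (d + m) + 2 <= Q)%N ->
  (Q ^ d * (d * Q) ^ m < size V ^ m)%N ->
  (forall v, v \in V -> lattice_point v) -> general_position V ->
  exists2 x, lattice_point x & in_interior_conv V x.
Proof.
move=> d0 m0 dV leQ small latV gpV.
set n := size V in dV small *.
have [z zE] : exists z : 'I_n -> 'rV[int]_d, forall i : 'I_n, V`_i = map_mx intr (z i).
  apply: (@fin_all_exists 'I_n (fun=> 'rV[int]_d) (fun i t => V`_i = map_mx intr t)) => i.
  by apply/lattice_point_int/latV/mem_nth.
have det_neq0 f : injective f -> \det (affine_mx (z \o f)) != 0.
  move=> f_inj; have := general_position_det gpV f_inj.
  have -> : affine_mx (fun i => V`_(f i)) = map_mx intr (affine_mx (z \o f)).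
    by rewrite map_affine_mx; apply: eq_affine_mx => i; exact: zE.
  by rewrite det_map_mx intr_eq0.
(* A prime above [D] divides none of the nonzero determinants. *)
pose D := (\max_(f : {ffun 'I_(d + 1) -> 'I_n}) `|\det (affine_mx (z \o f))|)%N.
(* The [d + m] weights are at most [2 * L] each, so with [L = p %/ B] their total is less than
   [L * B <= p]. *)
pose B := (2 * (d + m) + 1)%N.
have [p lt_p p_pr] := prime_above (maxn D B).
move: lt_p; rewrite gtn_max => /andP[Dp Bp].
have fiber_z : forall (y : 'rV['F_p]_d) c, y != 0 ->
    (#|[pred i | dot (map_mx intr (z i)) y == c]| <= d)%N.
  apply: Fp_fiber_bound p_pr _ => f f_inj; rewrite absz_gt0 det_neq0 //=.
  apply: leq_ltn_trans Dp.
  have := @leq_bigmax _ (fun f : {ffun 'I_(d + 1) -> 'I_n} =>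
    `|\det (affine_mx (z \o f))|%N) (finfun f).
  apply: leq_trans; rewrite leq_eqVlt; apply/orP; left; apply/eqP; congr absz.
  by congr (\det _); apply: eq_affine_mx => j /=; rewrite ffunE.
have d1n : (d + 1 <= n)%N by rewrite addn1.
(* The first [d + 1] vertices form the simplex; the last of them, [i0], becomes the origin and the
   others are the fixed indices. *)
pose f := widen_ord d1n.
have f_inj : injective f by move=> i j /(congr1 val) /= ?; exact: val_inj.
pose i0 := f (rshift d 0); pose b j := f (lshift 1 j).
pose x i := map_mx intr (z i - z i0) : 'rV['F_p]_d.
have dot_x i y : dot (x i) y = dot (map_mx intr (z i)) y - dot (map_mx intr (z i0)) y.
  by rewrite /x map_mxB dotBl.
have fiber_x y c : y != 0 -> (#|[pred i | dot (x i) y == c]| <= d)%N.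
  move=> /(fiber_z _ (c + dot (map_mx intr (z i0)) y)); apply: leq_trans.
  by apply/subset_leq_card/subsetP=> i; rewrite !inE dot_x subr_eq.
(* The fibre over 0 also contains [i0], since [x i0 = 0], hence would have [d + 1] elements. *)
have free_b y : (forall j, dot (x (b j)) y = 0) -> y = 0.
  move=> xb0; apply/eqP; case: eqVneq => // /(fiber_x _ 0); rewrite leqNgt => /negP[].
  rewrite -addn1 -[(d + 1)%N]card_ord -(card_imset predT f_inj).
  apply/subset_leq_card/subsetP => _ /imsetP[i _ ->]; rewrite inE.
  by case: (split_ordP i) => j ->; rewrite ?xb0 // (ord1 j) dot_x subrr.
pose L := (p %/ B)%N.
have B0 : (0 < B)%N by rewrite /B addn1.
have L0 : (0 < L)%N by rewrite divn_gt0 // ltnW.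
have LB : (L * B <= p)%N by exact: leq_trunc_div.
(* Since [L >= 1], [p < (L + 1) * B <= 2 * L * B], and [2 * B <= Q]. *)
have pLQ : (p <= L * Q)%N.
  have := ltn_ceil p B0; rewrite -/L; move: L0 leQ; rewrite /B; nia.
have Lp : (L <= p)%N by apply: leq_trans LB; rewrite leq_pmulr.
have [chi [chiD norm_chi chi1]] := Fp_additive_character p_pr.
(* The weight [p - H] that is left over goes to the vertex [i0]. *)
have [|[w r] /= s0] := exists_zero_config chiD norm_chi chi1
  (Fp_nat_inj p_pr Lp) (m := m) fiber_x free_b.
  by rewrite card_Fp //; exact: (counting_bound d0 m0 L0 pLQ small).
(* The integer lift of the zero sum is [p] times some [q]; dividing by [p] shows that [z i0 + q] is
   a convex combination of the vertices. *)
pose Z := \sum_j (weight (w j))%:Z *: (z (b j) - z i0)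
   + \sum_j (weight (r j).2)%:Z *: (z (r j).1 - z i0).
have [q Zq] : exists q, Z = p%:Z *: q.
  apply: map_mx_intr_Fp_eq0 p_pr _; rewrite -[RHS]s0 /config_sum map_mxD !raddf_sum /=.
  by congr (_ + _); apply: eq_bigr => j _; rewrite map_mxZ.
pose H := (\sum_j weight (w j) + \sum_j weight (r j).2)%N.
have Hp : (H < p)%N.
  have wL t : (@weight L t <= 2 * L)%N by rewrite /weight mul2n -addnn leq_add.
  have : (H <= \sum_(j < d) 2 * L + \sum_(j < m) 2 * L)%N by rewrite leq_add // leq_sum.
  rewrite !sum_nat_const !card_ord; move: LB L0; rewrite /B; nia.
have p0 : 0 < p%:R :> Rr by rewrite ltr0n prime_gt0.
pose lam := combined_weight i0 b (fun j => (r j).1) (fun j => (weight (w j))%:R / p%:R)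
   (fun j => (weight (r j).2)%:R / p%:R) ((p - H)%:R / p%:R : Rr).
exists (map_mx intr (z i0 + q)); first exact: lattice_point_map.
have lam1 : \sum_t lam t = 1.
  rewrite total_combined_weight -!mulr_suml -!mulrDl -!natr_sum -!natrD -/H subnKC 1?ltnW //.
  by rewrite divff ?gt_eqF.
have -> : map_mx intr (z i0 + q) = \sum_t lam t *: V`_t.
  rewrite sum_combined_weight.
  under eq_bigr => j _ do rewrite zE.
  under [X in _ + X + _]eq_bigr => j _ do rewrite zE.
  rewrite zE.
  apply/rowP=> k; rewrite !mxE !summxE.
  under eq_bigr => j _ do rewrite !mxE mulrAC.
  under [X in _ + X + _]eq_bigr => j _ do rewrite !mxE mulrAC.
  have := congr1 (fun u : 'rV_d => (u 0 k)%:~R : Rr) Zq.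
  rewrite !mxE !summxE !rmorphD rmorphM /= !rmorph_sum /=.
  under eq_bigr => j _ do rewrite !mxE rmorphM rmorphB mulrBr /= -pmulrn.
  under [X in _ + X = _]eq_bigr => j _ do rewrite !mxE rmorphM rmorphB mulrBr /= -pmulrn.
  rewrite !sumrB -!mulr_suml natrB 1?ltnW // /H natrD !natr_sum.
  have pn0 := lt0r_neq0 p0.
  move=> Zk; apply: (mulfI pn0).
  rewrite [LHS]mulrDr pmulrn -Zk.
  rewrite -!pmulrn.
  have barycenter (F : fieldType) (P c s1 s2 s3 s4 : F) : P != 0 ->
      P * c + (s1 - s2 * c + (s3 - s4 * c)) =
      P * (s1 / P + s3 / P + (P - (s2 + s4)) / P * c) by move=> P0; field.
  exact: barycenter.
(* On the simplex each weight is at least a positive integer over [p], whence this [eps]. *)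
apply: (interior_of_simplex_weights (eps := p%:R^-1) f_inj) => //.
- exact: general_position_det.
- move=> t; rewrite !addr_ge0 ?mulrn_wge0 ?sumr_ge0 // => *; exact: divr_ge0.
- by rewrite invr_gt0.
have inv_le k : (0 < k)%N -> p%:R^-1 <= k%:R / p%:R :> Rr.
  by move=> k0; rewrite ler_peMl ?invr_ge0 ?ler1n // ltW.
move=> i; case: (split_ordP i) => j ->.
  rewrite /lam /combined_weight (bigD1 j) //=.
  do 3![apply: ler_wpDr; first by rewrite ?mulrn_wge0 ?sumr_ge0 // => *; exact: divr_ge0].
  exact: inv_le.
rewrite (ord1 j) /lam /combined_weight eqxx; apply: ler_wpDl.
  by rewrite addr_ge0 ?sumr_ge0 // => *; exact: divr_ge0.
by apply: inv_le; rewrite subn_gt0.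
Qed.

(** * Choice of parameters and explicit constants *)

Lemma hollow_size_bound (d : nat) (V : seq 'rV[Rr]_d) : (2 <= d)%N ->
  (forall v, v \in V -> lattice_point v) -> general_position V ->
  (forall x, lattice_point x -> ~ in_interior_conv V x) ->
  (size V <= 90 * d ^ 2 * trunc_log 2 d)%N.
Proof.
move=> d2 latV gpV hollow; set l := trunc_log 2 d.
have l0 : (0 < l)%N by rewrite trunc_log_gt0 //=; lia.
have d_lt : (d < 2 ^ l.+1)%N by rewrite trunc_log_ltn.
(* This [m] gives [Q ^ d < 2 ^ m], and [size V >= 2 * (d * Q)] provides the factor [2 ^ m] over
   [(d * Q) ^ m]. *)
pose m := (d * (10 * l))%N; pose Q := (4 * (d + m) + 2)%N.
rewrite leqNgt; apply/negP => big_V.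
have dl : (d <= d * l)%N by rewrite leq_pmulr.
(* The constant 90 comes from [2 * Q = 8 * d + 80 * (d * l) + 4], where [d <= d * l] and
   [4 <= 2 * (d * l)]. *)
have dQ : (2 * (d * Q) <= size V)%N.
  apply: leq_trans (ltnW big_V); rewrite -mulnn.
  have -> : (2 * (d * Q) = d * (2 * Q))%N by ring.
  have -> : (90 * (d * d) * l = d * (90 * (d * l)))%N by ring.
  by rewrite leq_mul2l; apply/orP; right; rewrite /Q /m; lia.
have Q_lt : (Q < 2 ^ (10 * l))%N.
  apply: (@leq_trans (64 * (2 ^ l.+1 * 2 ^ l))).
    have l_lt : (l < 2 ^ l)%N by rewrite ltn_expl.
    have : (d * l <= 2 ^ l.+1 * 2 ^ l)%N by rewrite leq_mul // ltnW.
    by rewrite /Q /m; lia.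
  by rewrite -[64%N]/(2 ^ 6)%N -!expnD leq_exp2l //; lia.
have m0 : (0 < m)%N by rewrite /m; lia.
have dV : (d < size V)%N by move: dQ; rewrite /Q; nia.
have small : (Q ^ d * (d * Q) ^ m < size V ^ m)%N.
  apply: (@leq_trans ((2 * (d * Q)) ^ m)); last by rewrite leq_exp2r.
  rewrite [((2 * _) ^ m)%N]expnMn ltn_pmul2r; last by rewrite expn_gt0 muln_gt0 /Q; lia.
  by rewrite [in X in (_ < X)%N]/m [(d * _)%N]mulnC expnM ltn_exp2r //; lia.
have [x latx intx] :=
  exists_interior_lattice_point (ltnW d2) m0 dV (leqnn Q) small latV gpV.
exact: hollow latx intx.
Qed.

Lemma half_le_ln2 : 2^-1 <= ln 2.
Proof. exact/ltW/RltP/ln_lt_2. Qed.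

Lemma ln_natX2 (l : nat) : ln (2 ^+ l : Rr) = l%:R * ln 2.
Proof.
elim: l => [|l IHl]; first by rewrite expr0 mul0r; exact: ln_1.
have pos k : Rlt 0 (2 ^+ k : Rr) by apply/RltP; rewrite exprn_gt0.
rewrite -[l.+1%:R]natr1 mulrDl mul1r -IHl addrC exprS; exact: (ln_mult 2 _ (pos 1%N) (pos l)).
Qed.

Lemma trunc_log2_le_ln (d : nat) : (0 < d)%N ->
  (trunc_log 2 d)%:R * ln 2 <= ln (d%:R : Rr).
Proof.
move=> d0; rewrite -ln_natX2.
have : (2 ^+ trunc_log 2 d : Rr) <= d%:R by rewrite -natrX ler_nat trunc_logP.
rewrite le_eqVlt => /orP[/eqP-> //|lt]; apply/ltW/RltP/ln_increasing; apply/RltP => //.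
by rewrite exprn_gt0.
Qed.

Theorem theorem2p4 :
  exists C : Rr, 0 < C /\
    forall (d : nat), (2 <= d)%N ->
    forall V : seq 'rV[Rr]_d,
      vertex_set V ->
      (forall v, v \in V -> lattice_point v) ->
      general_position V ->
      (forall x : 'rV[Rr]_d, lattice_point x -> ~ in_interior_conv V x) ->
      (size V)%:R <= C * (d%:R) ^+ 2 * (ln d%:R) ^+ 3.
Proof.
(* Here [720 = 90 * 8]: the binary logarithm satisfies [l <= 2 * t] with [t = ln d], and
   [1 <= 4 * t ^+ 2] raises this to [l <= 8 * t ^+ 3]. *)
exists 720; split=> // d d2 V _ latV gpV hollow.
have := hollow_size_bound d2 latV gpV hollow; rewrite -(ler_nat Rr).
move=> /le_trans; apply; rewrite -mulnn !natrM -expr2.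
have d0 : (0 < d)%N by exact: ltnW.
have l1 : 1 <= (trunc_log 2 d)%:R :> Rr by rewrite ler1n trunc_log_gt0 //=; lia.
have := trunc_log2_le_ln d0; have := half_le_ln2.
set l := (trunc_log 2 d)%:R in l1 *; set t := ln d%:R; set c := ln 2 => c2 lc.
have lt2 : l <= 2 * t.
  apply: le_trans (_ : 2 * (l * c) <= _); last by rewrite ler_pM2l.
  by rewrite mulrCA ler_peMr ?(le_trans ler01) // -ler_pdivrMl // mulr1.
have t2 : 1 <= 4 * t ^+ 2.
  have -> : 4 * t ^+ 2 = (2 * t) ^+ 2 by ring.
  by rewrite exprn_ege1 // (le_trans l1).
have -> : 720 * d%:R ^+ 2 * t ^+ 3 = 90 * d%:R ^+ 2 * (2 * t * (4 * t ^+ 2)) by ring.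
rewrite ler_wpM2l ?mulr_ge0 ?exprn_ge0 // (le_trans lt2) // ler_peMr //.
by rewrite (le_trans _ lt2) // (le_trans ler01).
Qed.
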